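(* Let $\mathcal{G}$ be a minimal, essentially principal, ample, purely infinite groupoid. Then $\mathsf{F}(\mathcal{G})$ and $\mathsf{A}(\mathcal{G})$ do not have a solvable generalised word problem; that is, whenever either of these groups is finitely generated (so that the notion is defined), it does not have solvable generalised word problem.
   Context: A groupoid is a small category in which every morphism is invertible; $\mathcal{G}^{(0)}$ is its set of units, $s(\gamma)=\gamma^{-1}\gamma$, $r(\gamma)=\gamma\gamma^{-1}$. All topological groupoids are Hausdorff (and nonempty). A bisection is an open set $B\subseteq\mathcal{G}$ such that $s|_B$ and $r|_B$ are homeomorphisms onto open subsets of $\mathcal{G}^{(0)}$. $\mathcal{G}$ is ample if its compact open bisections form a basis of its topology. $\mathcal{G}$ is minimal if every orbit $\{r(\gamma): s(\gamma)=x\}$, $x\in\mathcal{G}^{(0)}$, is dense in $\mathcal{G}^{(0)}$. $\mathcal{G}$ is essentially principal if the set of $x\in\mathcal{G}^{(0)}$ with $\{\gamma: s(\gamma)=r(\gamma)=x\}=\{x\}$ is dense in $\mathcal{G}^{(0)}$. $\mathcal{G}$ is purely infinite if for every compact open $X\subseteq\mathcal{G}^{(0)}$ there are compact open bisections $B,B'$ with $s(B)=s(B')=X$ and with $r(B),r(B')$ disjoint and contained in $X$. Topological full group: for a compact open bisection $B$ with $s(B)=r(B)=K$, let $\alpha_B\in\mathrm{Homeo}(\mathcal{G}^{(0)})$ be $r\circ(s|_B)^{-1}$ on $K$ and the identity outside $K$. $\mathsf{F}(\mathcal{G})$ is the group of all such $\alpha_B$. The alternating group $\mathsf{A}(\mathcal{G})$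 is the subgroup of $\mathsf{F}(\mathcal{G})$ generated by the elements $g$ of order three for which there are disjoint compact open sets $X_0,X_1,X_2\subseteq\mathcal{G}^{(0)}$ with $g(X_j)=X_{j+1}$ (indices mod 3) and $g$ the identity outside $X_0\sqcup X_1\sqcup X_2$. A finitely generated group $\Gamma$ with finite generating set $S$ has solvable generalised word problem (with respect to $S$) if for all subgroups $\Lambda\subseteq\Gamma$ there exists an algorithm which, given a finite word $w$ in $S$, determines in finitely many steps whether $w$ belongs to $\Lambda$. *)

(* Defs.v *)
From HB Require Import structures.
From mathcomp Require Import all_boot.
From mathcomp Require Import all_classical topology.

Set Implicit Arguments.
Unset Strict Implicit.
Unset Printing Implicit Defensive.

Local Open Scope classical_set_scope.

(* A groupoid is identified with its set of arrows; units are the arrows of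
   the form [gsrc g].  [gmul g h] is meaningful only when [gsrc g = grng h]:
   the total function [gmul] is unconstrained elsewhere. *)
HB.mixin Record isGroupoid (G : Type) := {
  gsrc : G -> G;
  grng : G -> G;
  gmul : G -> G -> G;
  ginv : G -> G;
  gmul_src : forall g h, gsrc g = grng h -> gsrc (gmul g h) = gsrc h;
  gmul_rng : forall g h, gsrc g = grng h -> grng (gmul g h) = grng g;
  gmulA : forall g h k, gsrc g = grng h -> gsrc h = grng k ->
    gmul g (gmul h k) = gmul (gmul g h) k;
  gsrc_src : forall g, gsrc (gsrc g) = gsrc g;
  grng_src : forall g, grng (gsrc g) = gsrc g;
  gsrc_rng : forall g, gsrc (grng g) = grng g;
  grng_rng : forall g, grng (grng g) = grng g;
  gmul_g_src : forall g, gmul g (gsrc g) = g;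
  gmul_rng_g : forall g, gmul (grng g) g = g;
  ginv_src : forall g, gsrc (ginv g) = grng g;
  ginv_rng : forall g, grng (ginv g) = gsrc g;
  gmul_inv_g : forall g, gmul (ginv g) g = gsrc g;
  gmul_g_inv : forall g, gmul g (ginv g) = grng g
}.

#[short(type="groupoidType")]
HB.structure Definition Groupoid := {G of isGroupoid G}.

HB.mixin Record Groupoid_isTopGroupoid G of Groupoid G & Topological G := {
  ginv_continuous : continuous (@ginv G);
  gmul_continuous : {within [set p : G * G | gsrc p.1 = grng p.2],
    continuous (fun p : G * G => gmul p.1 p.2)}
}.

#[short(type="topGroupoidType")]
HB.structure Definition TopGroupoid :=
  {G of Groupoid_isTopGroupoid G & Groupoid G & Topological G}.

Definition units (G : groupoidType) : set G := range (@gsrc G).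
Arguments units : clear implicits.

Lemma units_src (G : groupoidType) (g : G) : gsrc g \in units G.
Proof. by apply/mem_set; exists g. Qed.

Lemma units_rng (G : groupoidType) (g : G) : grng g \in units G.
Proof. by apply/mem_set; exists (grng g); rewrite ?gsrc_rng. Qed.

(* The source and range maps with values in the unit space [units G], which
   carries the topology induced from [G]. *)
Definition src (G : groupoidType) (g : G) : units G :=
  exist _ (gsrc g) (units_src g).
Definition rng (G : groupoidType) (g : G) : units G :=
  exist _ (grng g) (units_rng g).

(* The restriction of [f] to [A] is a homeomorphism (for the subspace
   topologies) onto an open subset of [Y]. *)
Definition homeo_onto_open (X Y : topologicalType) (f : X -> Y) (A : set X) :=
  [/\ open (f @` A), {within A, continuous f} &
      exists2 h : Y -> X, {within f @` A, continuous h} &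
        forall x, A x -> h (f x) = x].

Section GroupoidProperties.
Variable G : topGroupoidType.

Definition bisection (B : set G) :=
  [/\ open B, homeo_onto_open (@src G) B & homeo_onto_open (@rng G) B].

Definition compact_open_bisection (B : set G) := compact B /\ bisection B.

Definition ample := basis compact_open_bisection.

Definition orbit_of (x : units G) : set (units G) :=
  @rng G @` [set g | src g = x].

Definition minimal := forall x : units G, dense (orbit_of x).

Definition essentially_principal :=
  dense [set x : units G | [set g : G | src g = x /\ rng g = x] = [set val x]].

Definition purely_infinite :=
  forall X : set (units G), compact X -> open X ->
  exists B B' : set G,
    [/\ compact_open_bisection B, compact_open_bisection B',
        @src G @` B = X & @src G @` B' = X] /\
    [/\ (@rng G @` B) `&` (@rng G @` B') = set0,
        @rng G @` B `<=` X & @rng G @` B' `<=` X].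

End GroupoidProperties.

Record homeo (X : topologicalType) := Homeo {
  homeo_fun :> X -> X;
  homeo_inv : X -> X;
  homeo_continuous : continuous homeo_fun;
  homeo_inv_continuous : continuous homeo_inv;
  homeoK : cancel homeo_fun homeo_inv;
  homeoVK : cancel homeo_inv homeo_fun
}.

Section HomeoGroup.
Variable X : topologicalType.
Implicit Types f g h : homeo X.

Lemma homeo_eq f g : f =1 g -> f = g.
Proof.
case: f g => [f f' cf cf' fK f'K] [g g' cg cg' gK g'K] /= fg.
have {fg} E : f = g by apply/funext.
have E' : f' = g'.
  by apply/funext => x; rewrite -[x in RHS]f'K E gK.
by subst; congr Homeo; apply: Prop_irrelevance.
Qed.

Lemma homeo_id_continuous : continuous (@id X).
Proof. by move=> x; apply: cvg_id. Qed.

Definition homeo_one : homeo X :=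
  @Homeo X id id homeo_id_continuous homeo_id_continuous (fun=> erefl) (fun=> erefl).

Definition homeo_inverse f : homeo X :=
  Homeo (@homeo_inv_continuous _ f) (@homeo_continuous _ f)
        (@homeoVK _ f) (@homeoK _ f).

Lemma homeo_comp_continuous f g : continuous (f \o g).
Proof. by move=> x; apply: continuous_comp; apply: homeo_continuous. Qed.

Lemma homeo_comp_inv_continuous f g :
  continuous (homeo_inv g \o homeo_inv f).
Proof. by move=> x; apply: continuous_comp; apply: homeo_inv_continuous. Qed.

Definition homeo_comp f g : homeo X :=
  @Homeo X (f \o g) (homeo_inv g \o homeo_inv f)
    (@homeo_comp_continuous f g) (@homeo_comp_inv_continuous f g)
    (can_comp (@homeoK _ f) (@homeoK _ g))
    (can_comp (@homeoVK _ g) (@homeoVK _ f)).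

Lemma homeo_compA : associative homeo_comp.
Proof. by move=> f g h; apply: homeo_eq. Qed.
Lemma homeo_comp1f : left_id homeo_one homeo_comp.
Proof. by move=> f; apply: homeo_eq. Qed.
Lemma homeo_compf1 : right_id homeo_one homeo_comp.
Proof. by move=> f; apply: homeo_eq. Qed.
Lemma homeo_compVf : left_inverse homeo_one homeo_inverse homeo_comp.
Proof. by move=> f; apply: homeo_eq => x /=; rewrite homeoK. Qed.
Lemma homeo_compfV : right_inverse homeo_one homeo_inverse homeo_comp.
Proof. by move=> f; apply: homeo_eq => x /=; rewrite homeoVK. Qed.

HB.instance Definition _ := gen_eqMixin (homeo X).
HB.instance Definition _ := gen_choiceMixin (homeo X).
HB.instance Definition _ := isGroup.Build (homeo X)
  homeo_compA homeo_comp1f homeo_compf1 homeo_compVf homeo_compfV.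

End HomeoGroup.

Definition subgroup (H : groupType) (K : set H) := group_closed [in K].

Definition generated (H : groupType) (E : set H) : set H :=
  smallest (@subgroup H) E.

Section FullGroup.
Variable G : topGroupoidType.

Definition is_alpha (B : set G) (phi : homeo (units G)) :=
  (forall g, B g -> phi (src g) = rng g) /\
  (forall x, ~ (@src G @` B) x -> phi x = x).

Definition full_group : set (homeo (units G)) :=
  [set phi | exists B : set G,
     [/\ compact_open_bisection B, @src G @` B = @rng G @` B
       & is_alpha B phi]].

(* [ordS] is the cyclic successor on ['I_3]. *)
Definition three_cycle (phi : homeo (units G)) :=
  [/\ full_group phi, phi <> 1%g, (phi ^+ 3)%g = 1%g &
      exists X : 'I_3 -> set (units G),
        [/\ forall j, compact (X j) /\ open (X j),
            trivIset setT X,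
            forall j, phi @` X j = X (ordS j) &
            forall x, ~ (\bigcup_j X j) x -> phi x = x]].

Definition alternating_group : set (homeo (units G)) := generated three_cycle.

End FullGroup.

Arguments full_group : clear implicits.
Arguments alternating_group : clear implicits.

(* Algorithms are Minsky counter machines with unboundedly many registers.
   [Inc r q] increments register [r] and jumps to [q]; [Dec r q q'] decrements
   register [r] and jumps to [q] if [r] is nonzero, and jumps to [q']
   otherwise.  A machine halts when its program counter leaves the program. *)
Inductive instr := Inc of nat & nat | Dec of nat & nat & nat.

Definition program := seq instr.

Definition config : Type := nat * (nat -> nat).

Definition set_reg (c : nat -> nat) (r x : nat) : nat -> nat :=
  fun i => if i == r then x else c i.

Definition step (p : program) (c : config) : config :=
  match onth p c.1 with
  | Some (Inc r q) => (q, set_reg c.2 r (c.2 r).+1)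
  | Some (Dec r q q') =>
      if c.2 r is m.+1 then (q, set_reg c.2 r m) else (q', c.2)
  | None => c
  end.

(* Input and output are in register 0; all other registers start at 0. *)
Definition computes (p : program) (x y : nat) :=
  exists k, let c := iter k (step p) (0, set_reg (fun=> 0) 0 x) in
    size p <= c.1 /\ c.2 0 = y.

(* Finite words in letters [S i] and their inverses: [(i, true)] stands for
   the inverse of [S i]. *)
Definition word n := seq ('I_n * bool).

Definition word_code n (w : word n) : nat :=
  CodeSeq.code [seq (nat_of_ord l.1).*2 + nat_of_bool l.2 | l <- w].

Definition decidable_words n (L : set (word n)) :=
  exists p : program, forall w, computes p (word_code w) `[< L w >].

Section GeneralisedWordProblem.
Variables (H : groupType) (n : nat) (S : 'I_n -> H).

Definition word_val (w : word n) : H :=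
  (\prod_(l <- w) (if l.2 then (S l.1)^-1 else S l.1))%g.

Definition solvable_gwp (Gamma : set H) :=
  forall Lambda : set H, subgroup Lambda -> Lambda `<=` Gamma ->
    decidable_words [set w | Lambda (word_val w)].

End GeneralisedWordProblem.

(* Main.v *)
(* Programs are countably many, so it suffices to find uncountably many
   subgroups.  Pure infiniteness of a nonempty compact open set X gives an
   embedding beta of X into itself and a nonempty compact open subset Z of X
   disjoint from beta(X); the sets beta^n(Z) are then pairwise disjoint.  For
   each i, beta induces a three-cycle tau_i of beta^(3i)(Z), beta^(3i+1)(Z) and
   beta^(3i+2)(Z).  For a set I of natural numbers, the elements acting
   trivially on beta^(3i)(Z) for all i outside I form a subgroup, which contains
   tau_i exactly when i lies in I. *)
Require Import Defs.
From HB Require Import structures.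
From mathcomp Require Import all_boot.
From mathcomp Require Import all_classical topology.
From mathcomp Require Import zify.

Set Implicit Arguments.
Unset Strict Implicit.
Unset Printing Implicit Defensive.

Local Open Scope classical_set_scope.

(** * Decidability *)

(** Coding instructions by a countable type makes [program] countable, so that each program gets a
    number through [pickle]. *)
Definition instr_encode (i : instr) : nat * nat + nat * nat * nat :=
  match i with Inc r q => inl (r, q) | Dec r q q' => inr (r, q, q') end.

Definition instr_decode (c : nat * nat + nat * nat * nat) : instr :=
  match c with inl (r, q) => Inc r q | inr (r, q, q') => Dec r q q' end.

Lemma instr_encodeK : cancel instr_encode instr_decode.
Proof. by case. Qed.

HB.instance Definition _ := Countable.copy instr (can_type instr_encodeK).

Lemma step_halted (p : program) (c : config) (k : nat) :
  size p <= c.1 -> iter k (step p) c = c.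
Proof.
move=> hc; have E : step p c = c by rewrite /step onth_default.
by elim: k => //= k ->.
Qed.

(** A halted configuration is a fixed point of [step], so the longer of two halting runs ends where
    the shorter one did. *)
Lemma computes_inj (p : program) (x y y' : nat) :
  computes p x y -> computes p x y' -> y = y'.
Proof.
move=> [k [hk <-]] [k' [hk' <-]].
wlog le_kk' : k k' hk hk' / k <= k'.
  by move=> W; case: (leqP k k') => [|/ltnW] le; [|symmetry]; apply: W.
by rewrite -(subnK le_kk') iterD (step_halted (c := iter k _ _)).
Qed.

(** * Subgroups, words and diagonalisation *)

Lemma subgroupP (H : groupType) (K : set H) :
  subgroup K <-> K 1%g /\ forall u v, K u -> K v -> K (u * v^-1)%g.
Proof.
split=> [[K1 KV]|[K1 KV]]; split.
- by move: K1; rewrite !inE.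
- by move=> u v Ku Kv; have := KV u v; rewrite !inE; apply.
- by rewrite !inE.
- by move=> u v; rewrite !inE; apply: KV.
Qed.

Lemma generated_subgroup (H : groupType) (E : set H) : subgroup (generated E).
Proof.
apply/subgroupP; split=> [K [/subgroupP[K1 _] _] //|u v Eu Ev K KE].
have [/subgroupP[_ KV] _] := KE.
by apply: KV; [apply: Eu | apply: Ev].
Qed.

(** The values of words form a subgroup containing the letters: concatenation gives products, and
    reversing a word while flipping its signs gives inverses. *)
Lemma generated_word (H : groupType) (n : nat) (S : 'I_n -> H) (g : H) :
  generated (range S) g -> exists w, word_val S w = g.
Proof.
move: g; apply: (@smallest_sub _ _ _ [set g | exists w, word_val S w = g]);
  last first.
  by move=> _ [i _ <-]; exists [:: (i, false)]; rewrite /word_val big_seq1.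
apply/subgroupP; split; first by exists [::]; rewrite /word_val big_nil.
move=> _ _ [w <-] [w' <-].
exists (w ++ rev [seq (l.1, ~~ l.2) | l <- w']).
rewrite /word_val big_cat /=; congr (_ * _)%g.
elim: w' => [|l s IH]; first by rewrite !big_nil invg1.
rewrite /= rev_cons -cats1 big_cat big_seq1 big_cons invgM IH /=.
by case: l.2 => //=; rewrite invgK.
Qed.

(* Cantor's diagonal argument: a program decides at most one set of words, and
   there are only countably many programs. *)
Lemma not_solvable_gwp (H : groupType) (n : nat) (S : 'I_n -> H)
    (Gamma : set H) (tau : nat -> H) (Lambda : set nat -> set H) :
  generated (range S) = Gamma -> (forall i, Gamma (tau i)) ->
  (forall I, subgroup (Lambda I)) -> (forall I, Lambda I `<=` Gamma) ->
  (forall I i, Lambda I (tau i) <-> I i) ->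
  ~ solvable_gwp S Gamma.
Proof.
move=> genS Gtau LS LG Ltau solv.
have /choice[w wE] i : exists w, word_val S w = tau i.
  by apply: generated_word; rewrite genS.
(* The diagonal set: numbers of programs that do not answer 1 on the word for their own [tau]. *)
pose I := [set i | exists2 p : program,
  pickle p = i & ~ computes p (word_code (w i)) 1].
have [p pI] := solv _ (LS I) (LG I).
have {pI} := pI (w (pickle p)).
(* At its own number, [p] is refuted either way: an answer 1 contradicts membership in [I], and an
   answer 0 forces it. *)
case: asboolP => /=; rewrite wE => Ip.
  by have /Ltau[q /(pcan_inj pickleK) <-] := Ip.
have [Hp|Hp _] := pselect (computes p (word_code (w (pickle p))) 1).
  by move/(computes_inj Hp).
by apply: Ip; apply/Ltau; exists p.
Qed.

(** The subgroup attached to [I] consists of the elements of [Gamma] fixing [U i] pointwise for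
    every [i] outside [I]. *)
Lemma homeo_not_solvable_gwp (X : topologicalType) (n : nat)
    (S : 'I_n -> homeo X) (Gamma : set (homeo X))
    (tau : nat -> homeo X) (U : nat -> set X) :
  generated (range S) = Gamma -> (forall i, Gamma (tau i)) ->
  (forall i, exists2 x, U i x & tau i x <> x) ->
  (forall i j x, i <> j -> U j x -> tau i x = x) ->
  ~ solvable_gwp S Gamma.
Proof.
move=> genS Gtau tauU tauV.
apply: (@not_solvable_gwp _ _ _ _ tau (fun I => Gamma `&`
  [set g | forall i x, ~ I i -> U i x -> g x = x])) => [//|//|I|I g []//|I i].
- have /subgroupP[G1 GV] := generated_subgroup (range S).
  apply/subgroupP; split; first by rewrite -genS.
  move=> u v [Gu u1] [Gv v1]; split; first by rewrite -genS in Gu Gv *; apply: GV.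
  move=> i x nIi Ux; change (u (homeo_inv v x) = x).
  by rewrite -{1}(v1 _ _ nIi Ux) homeoK (u1 _ _ nIi Ux).
- split=> [[_ ti]|Ii]; last first.
    by split=> // j x nIj; apply: tauV => ij; apply: nIj; rewrite -ij.
  have [x Ux tx] := tauU i.
  by have [//|nIi] := pselect (I i); case: tx; apply: ti Ux.
Qed.

(** * Continuity on open subsets *)

Lemma continuous_eq_on_open (X Y : topologicalType) (f g : X -> Y) (U : set X)
    (x : X) :
  open U -> U x -> (forall y, U y -> f y = g y) ->
  {for x, continuous f} -> {for x, continuous g}.
Proof.
move=> oU Ux fg cf.
change (g y @[y --> x] --> g x); rewrite -fg //.
apply: cvg_trans cf; apply: near_eq_cvg.
by apply: filterS (open_nbhs_nbhs (conj oU Ux)) => y /fg.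
Qed.

Lemma open_preimage_in (X Y : topologicalType) (f : X -> Y) (V : set X)
    (U : set Y) :
  open V -> (forall x, V x -> {for x, continuous f}) -> open U ->
  open (V `&` f @^-1` U).
Proof.
move=> oV cf oU; rewrite openE => x [Vx Ux]; apply: filterI.
  exact: open_nbhs_nbhs.
exact/cf/open_nbhs_nbhs.
Qed.

Lemma within_continuous_open (X Y : topologicalType) (f : X -> Y) (V : set X) :
  open V ->
  {within V, continuous f} <-> (forall x, V x -> {for x, continuous f}).
Proof.
move=> oV; rewrite continuous_open_subspace //.
by split=> [cf x /mem_set|cf x /set_mem]; apply: cf.
Qed.

(** * Ample groupoids *)

Section Groupoid.
Variable G : topGroupoidType.
Hypothesis Ghausdorff : hausdorff_space G.
Hypothesis Gample : ample G.
Implicit Types (g h : G) (x y : units G).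

Lemma src_ginv g : src (ginv g) = rng g.
Proof. by apply: val_inj; rewrite /= ginv_src. Qed.

Lemma rng_ginv g : rng (ginv g) = src g.
Proof. by apply: val_inj; rewrite /= ginv_rng. Qed.

Lemma src_gmul g h : src g = rng h -> src (gmul g h) = src h.
Proof. by move=> /(congr1 val) gh; apply: val_inj; apply: gmul_src. Qed.

Lemma rng_gmul g h : src g = rng h -> rng (gmul g h) = rng g.
Proof. by move=> /(congr1 val) gh; apply: val_inj; apply: gmul_rng. Qed.

Lemma src_unit x : src (val x) = x.
Proof.
by apply: val_inj; case: x => _ /= /set_mem[g _ <-]; rewrite gsrc_src.
Qed.

Lemma rng_unit x : rng (val x) = x.
Proof.
by apply: val_inj; case: x => _ /= /set_mem[g _ <-]; rewrite grng_src.
Qed.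

Lemma bisection_src_inj (D : set G) g h :
  bisection D -> D g -> D h -> src g = src h -> g = h.
Proof. by move=> [_ [_ _ [k _ kK]] _] Dg Dh gh; rewrite -(kK g) // gh kK. Qed.

Lemma ample_bisection g : exists2 D : set G, compact_open_bisection D & D g.
Proof.
have [_ /(_ g) /(_ setT) []] := Gample; first exact: filterT.
by move=> D [cD Dg] _; exists D.
Qed.

Lemma src_continuous : continuous (@src G).
Proof.
move=> g; have [D [_ [oD [_ cs _] _]] Dg] := ample_bisection g.
by move/(within_continuous_open _ oD): cs; apply.
Qed.

Lemma rng_continuous : continuous (@rng G).
Proof.
move=> g; have [D [_ [oD _ [_ cs _]]] Dg] := ample_bisection g.
by move/(within_continuous_open _ oD): cs; apply.
Qed.

Lemma units_hausdorff : hausdorff_space (units G).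
Proof.
move=> x y xy; apply/val_inj/Ghausdorff => A B nA nB.
have cv : continuous (val : units G -> G) by exact: initial_continuous.
have [z [Az Bz]] := xy _ _ (cv x _ nA) (cv y _ nB).
by exists (val z).
Qed.

(** Multiplication is continuous only within the composable pairs, so composability is required on a
    neighbourhood of [p]. *)
Lemma continuous_gmul (T : topologicalType) (f k : T -> G) (p : T) :
  (\forall z \near p, src (f z) = rng (k z)) ->
  {for p, continuous f} -> {for p, continuous k} ->
  {for p, continuous (fun z => gmul (f z) (k z))}.
Proof.
move=> fk cf ck.
have := @gmul_continuous G; rewrite subspace_continuousP.
move=> /(_ (f p, k p)) /=.
have fkp : gsrc (f p) = grng (k p) by have /(congr1 val) := nbhs_singleton fk.
move=> /(_ fkp) cm A /cm.
have cfk : (f z, k z) @[z --> p] --> nbhs (f p, k p) by exact: cvg_pair.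
move=> /cfk {cm cfk} /= mA.
by apply: filterS2 fk mA => z /(congr1 val) /= fkz; apply.
Qed.

(* A continuous section of [src] has open image because [src] is injective on
   bisections, which form a basis. *)
Lemma open_section (t : units G -> G) (K : set (units G)) :
  open K -> (forall x, K x -> {for x, continuous t}) ->
  (forall x, K x -> src (t x) = x) -> open (t @` K).
Proof.
move=> oK ct st; rewrite openE => _ [x Kx <-].
have [D [_ bD] Dt] := ample_bisection (t x).
have oD : open D by case: bD.
have oV := open_preimage_in oK ct oD.
have : nbhs (t x) (D `&` @src G @^-1` (K `&` t @^-1` D)).
  apply: filterI; first exact: open_nbhs_nbhs.
  by apply: src_continuous; rewrite st //; apply: open_nbhs_nbhs.
apply: filterS => g [Dg [Kg Dtg]]; exists (src g) => //.
by apply: (bisection_src_inj bD) => //; rewrite st.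
Qed.

(** The witnessing bisection is the image of [K] under [t]. On it, [src] has inverse [t], and [rng]
    has inverse [t] composed with the inverse of [phi]. *)
Lemma full_group_section (t : units G -> G) (phi : homeo (units G))
    (K : set (units G)) :
  continuous t -> (forall x, src (t x) = x) -> (forall x, phi x = rng (t x)) ->
  compact K -> open K -> phi @` K = K -> (forall x, ~ K x -> phi x = x) ->
  full_group G phi.
Proof.
move=> ct st phiE cK oK phiK phi1.
have sK : @src G @` (t @` K) = K.
  by rewrite image_comp (@eq_image_id _ (_ \o _)) // => x _; apply: st.
have rK : @rng G @` (t @` K) = K.
  by rewrite -[RHS]phiK image_comp; apply: eq_imagel => x _; rewrite /= phiE.
exists (t @` K); split.
- split; first by apply: continuous_compact cK; apply: continuous_subspaceT.
  split; first by apply: open_section => // x _; apply: ct.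
  + split; [by rewrite sK | apply: continuous_subspaceT; exact: src_continuous|].
    exists t; first exact: continuous_subspaceT.
    by move=> _ [x _ <-]; rewrite st.
  + split; [by rewrite rK | apply: continuous_subspaceT; exact: rng_continuous|].
    exists (t \o homeo_inv phi).
      apply: continuous_subspaceT => x.
      by apply: continuous_comp; [apply: homeo_inv_continuous | apply: ct].
    by move=> _ [x _ <-] /=; rewrite -phiE homeoK.
- by rewrite sK rK.
- split=> [_ [x _ <-]|x]; first by rewrite st phiE.
  by rewrite sK; apply: phi1.
Qed.

(** * Self-embeddings and three-cycles *)

(* [fun x => rng (b x)] is a homeomorphism from [X] onto an open subset of
   [X], with inverse [fun y => rng (c y)]. *)
Record self_embedding (X : set (units G)) (b c : units G -> G) := {
  emb_open : open ((fun x => rng (b x)) @` X);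
  emb_sub : (fun x => rng (b x)) @` X `<=` X;
  emb_continuous : forall x, X x -> {for x, continuous b};
  emb_src : forall x, X x -> src (b x) = x;
  emb_inv_continuous :
    forall x, X x -> {for rng (b x), continuous c};
  emb_inv : forall x, X x -> c (rng (b x)) = ginv (b x)
}.

Lemma bisection_self_embedding (B : set G) (X : set (units G)) :
  bisection B -> @src G @` B = X -> @rng G @` B `<=` X ->
  exists b c : units G -> G,
    self_embedding X b c /\ (fun x => rng (b x)) @` X = @rng G @` B.
Proof.
move=> [oB [os _ [b cb bK]] [or _ [c cc cK]]] sB rB.
have E : (fun x => rng (b x)) @` X = @rng G @` B.
  rewrite -sB image_comp; apply: eq_imagel => g Bg /=; by rewrite bK.
(* Here [b] inverts [src] on [B] and [c] inverts [rng]; taking [ginv] turns the arrow ending at a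
   point into one starting there. *)
exists b, (@ginv G \o c); split=> //; split.
- by rewrite E.
- by rewrite E.
- by rewrite -sB; apply/within_continuous_open.
- by rewrite -sB => _ [g Bg <-]; rewrite bK.
- rewrite -sB => _ [g Bg <-]; rewrite bK //.
  apply: continuous_comp; last exact: ginv_continuous.
  by move/(within_continuous_open _ or): cc; apply; exists g.
- by rewrite -sB => _ [g Bg <-] /=; rewrite bK // cK.
Qed.

Section SelfEmbedding.
Variables (X : set (units G)) (b c : units G -> G).
Hypothesis bc : self_embedding X b c.

Let beta x := rng (b x).
Let gamma x := rng (c x).

Lemma emb_invK x : X x -> gamma (beta x) = x.
Proof. by move=> Xx; rewrite /gamma (emb_inv bc) // rng_ginv (emb_src bc). Qed.

Lemma emb_inv_src x : X x -> src (c (beta x)) = beta x.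
Proof. by move=> Xx; rewrite (emb_inv bc) // src_ginv. Qed.

Lemma emb_in x : X x -> X (beta x).
Proof. by move=> Xx; apply: (emb_sub bc); exists x. Qed.

Lemma emb_image_compact (A : set (units G)) :
  open A -> compact A -> A `<=` X -> compact (beta @` A).
Proof.
move=> oA cA AX; apply: continuous_compact cA.
apply/within_continuous_open => // x /AX Xx.
by apply: continuous_comp; [apply: (emb_continuous bc) | apply: rng_continuous].
Qed.

Lemma emb_image_open (A : set (units G)) :
  open A -> A `<=` X -> open (beta @` A).
Proof.
move=> oA AX.
have -> : beta @` A = beta @` X `&` gamma @^-1` A.
  apply/seteqP; split=> [_ [x Ax <-]|_ [[x Xx <-]]].
    by split; [exists x => //; apply: AX | rewrite /= emb_invK //; apply: AX].
  by rewrite /= emb_invK // => Ax; exists x.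
apply: open_preimage_in => //; first exact: (emb_open bc).
move=> _ [x Xx <-]; apply: continuous_comp; last exact: rng_continuous.
exact: (emb_inv_continuous bc).
Qed.

(** The cycle applies [beta] on the first two sets and goes back by [gamma] twice on the third. It
    is built as [rng] of a continuous section [t] of [src], which places it in the full group. *)
Lemma emb_three_cycle (A : set (units G)) :
  open A -> compact A -> A `<=` X -> A !=set0 ->
  (forall x, A x -> (beta @` A) x -> False) ->
  (forall x, A x -> (beta @` (beta @` A)) x -> False) ->
  (forall x, (beta @` A) x -> (beta @` (beta @` A)) x -> False) ->
  exists phi : homeo (units G),
    [/\ three_cycle phi, forall x, A x -> phi x = beta x &
     forall x, ~ A x -> ~ (beta @` A) x -> ~ (beta @` (beta @` A)) x ->
       phi x = x].
Proof.
set A1 := beta @` A; set A2 := beta @` A1 => oA cA AX [x0 Ax0] d01 d02 d12.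
have A1X : A1 `<=` X by move=> _ [x /AX/emb_in ? <-].
have A2X : A2 `<=` X by move=> _ [x /A1X/emb_in ? <-].
have oA1 : open A1 by exact: emb_image_open.
have oA2 : open A2 by exact: emb_image_open.
have cA1 : compact A1 by exact: emb_image_compact.
have cA2 : compact A2 by exact: emb_image_compact.
pose K := A `|` A1 `|` A2.
have oK : open K by do 2?apply: openU.
have cK : compact K by do 2?apply: compactU.
(* With the complement open too, [t] can be glued from continuous pieces on open sets. *)
have oK' : open (~` K).
  exact/closed_openC/(compact_closed units_hausdorff cK).
(* For [x = beta (beta z)] with [z] in [A], this is the arrow from [x] back to [z]. *)
pose d x := gmul (c (gamma x)) (c x).
pose t x := if x \in A `|` A1 then b x else if x \in A2 then d x else val x.
have tb x : (A `|` A1) x -> t x = b x by move=> ?; rewrite /t mem_set.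
have td x : A2 x -> t x = d x.
  move=> A2x; rewrite /t memNset ?mem_set // => -[] ?.
    exact: d02 A2x.
  exact: d12 A2x.
have tv x : ~ K x -> t x = val x.
  by move=> nK; rewrite /t !memNset // => ?; apply: nK; [right|left].
have dcomp x : A2 x -> src (c (gamma x)) = rng (c x).
  move=> [_ [z /AX Xz <-] <-]; have Xbz := emb_in Xz.
  by rewrite emb_invK // emb_inv_src // -[LHS](emb_invK Xbz).
have AA1X : A `|` A1 `<=` X by move=> x [/AX|/A1X].
have ct : continuous t.
  move=> x; have [AA1x|nAA1] := pselect ((A `|` A1) x).
    apply: (continuous_eq_on_open (openU oA oA1)) => [|y /tb ->|] //.
    exact: (emb_continuous bc (AA1X _ AA1x)).
  have [A2x|nA2] := pselect (A2 x).
    apply: (@continuous_eq_on_open _ _ d t A2) => //; first by move=> y /td ->.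
    have cc y : A2 y -> {for y, continuous c}.
      by move=> [z /A1X Xz <-]; apply: (emb_inv_continuous bc).
    have cg y : A2 y -> {for y, continuous gamma}.
      move=> A2y.
      by apply: continuous_comp; [apply: cc | apply: rng_continuous].
    apply: continuous_gmul; last exact: cc.
      by apply: filterS (open_nbhs_nbhs (conj oA2 A2x)).
    apply: continuous_comp; first exact: cg.
    case: A2x => _ [z Az <-] <-; rewrite emb_invK; last exact/emb_in/AX.
    exact/(emb_inv_continuous bc)/AX.
  apply: (@continuous_eq_on_open _ _ (val : units G -> G) t (~` K)) => //.
  - by case.
  - by move=> y /tv ->.
  - exact: initial_continuous.
have st x : src (t x) = x.
  have [AA1x|nAA1] := pselect ((A `|` A1) x).
    by rewrite tb // (emb_src bc) //; apply: AA1X.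
  have [A2x|nA2] := pselect (A2 x).
    rewrite td // src_gmul; last exact: dcomp.
    by case: A2x => y /A1X Xy <-; rewrite emb_inv_src.
  by rewrite tv ?src_unit // => -[].
pose f x := rng (t x).
have f0 x : A x -> f x = beta x by move=> Ax; rewrite /f tb //; left.
have f1 x : A1 x -> f x = beta x by move=> Ax; rewrite /f tb //; right.
have f2 x : A x -> f (beta (beta x)) = x.
  move=> Ax; have A2x : A2 (beta (beta x)) by exists (beta x) => //; exists x.
  rewrite /f td // rng_gmul; last exact: dcomp.
  have Xx := AX _ Ax; have Xbx := emb_in Xx.
  by rewrite -[RHS](emb_invK Xx) -[in RHS](emb_invK Xbx).
have fv x : ~ K x -> f x = x by move=> nK; rewrite /f tv // rng_unit.
have cf : continuous f.
  by move=> x; apply: continuous_comp; [apply: ct | apply: rng_continuous].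
have A1b x : A x -> A1 (beta x) by exists x.
have A2b x : A1 x -> A2 (beta x) by exists x.
have fff x : f (f (f x)) = x.
  have [|nK] := pselect (K x); last by rewrite !fv.
  case=> [[Ax|[y Ay <-]]|[_ [y Ay <-] <-]].
  - by rewrite (f0 x Ax) (f1 _ (A1b _ Ax)) f2.
  - by rewrite (f1 _ (A1b _ Ay)) (f2 y Ay) f0.
  - by rewrite (f2 y Ay) (f0 y Ay) f1 //; apply: A1b.
(* As [f] has cube the identity, its inverse [f \o f] is continuous at once. *)
pose phi : homeo (units G) := @Homeo _ f (f \o f) cf
  (fun x => continuous_comp (cf x) (cf (f x))) fff fff.
pose Xs (j : 'I_3) := match val j with 0 => A | 1 => A1 | _ => A2 end.
have fA : f @` A = A1 by apply: eq_imagel => x Ax; apply: f0.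
have fA1 : f @` A1 = A2 by apply: eq_imagel => x Ax; apply: f1.
have fA2 : f @` A2 = A.
  apply/seteqP; split=> [_ [_ [_ [y Ay <-] <-] <-]|x Ax]; first by rewrite f2.
  by exists (beta (beta x)); [apply/A2b/A1b | apply: f2].
exists phi; split=> [||x nA nA1 nA2]; [|exact: f0|by apply: fv => -[[]|]].
split.
- apply: (full_group_section (t := t) (K := K)) => //.
  by rewrite /= !image_setU fA fA1 fA2 /K setUC setUA.
- move=> phi1; apply: (d01 (f x0)).
    by have /= := congr1 (fun h : homeo _ => h x0) phi1 => ->.
  by rewrite f0 //; apply: A1b.
- by apply: homeo_eq => x; apply: fff.
- exists Xs; split.
  + by case=> [[|[|[]]]] //= ?; split.
  + move=> [[|[|[|//]]] i] [[|[|[|//]]] j] _ _ [x [/= h k]];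
      apply: val_inj => //=; exfalso;
      solve [exact: (d01 x h k) | exact: (d01 x k h) | exact: (d02 x h k)
      | exact: (d02 x k h) | exact: (d12 x h k) | exact: (d12 x k h)].
  + by case=> [[|[|[]]]] //= ?.
  + move=> x nX; apply: fv => -[[Ax|Ax]|Ax]; apply: nX.
    * by exists ord0.
    * by exists (inord 1) => //; rewrite /Xs /= inordK.
    * by exists (inord 2) => //; rewrite /Xs /= inordK.
Qed.

Lemma emb_iter_disjoint (Z : set (units G)) :
  Z `<=` X -> (forall x, Z x -> (beta @` X) x -> False) ->
  forall m n x, m < n ->
    iter m (image^~ beta) Z x -> iter n (image^~ beta) Z x -> False.
Proof.
move=> ZX dZ.
have ZnX n : iter n (image^~ beta) Z `<=` X.
  by elim: n => //= n IH _ [x /IH/emb_in ? <-].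
elim=> [|m IH] [//|n] x mn /=.
  by move=> Zx [y /ZnX Xy yx]; apply: dZ Zx _; exists y.
move=> [y Zy <-] [z Zz zy]; apply: (IH n y) => //.
by rewrite -(emb_invK (ZnX _ _ Zy)) -zy (emb_invK (ZnX _ _ Zz)).
Qed.

End SelfEmbedding.

End Groupoid.

(** * A sequence of three-cycles and the theorem *)

Lemma disjoint_three_cycles (G : topGroupoidType) :
  [set: G] !=set0 -> hausdorff_space G -> ample G -> purely_infinite G ->
  exists (tau : nat -> homeo (units G)) (U : nat -> set (units G)),
    [/\ forall i, three_cycle (tau i),
        forall i, exists2 x, U i x & tau i x <> x &
        forall i j x, i <> j -> U j x -> tau i x = x].
Proof.
move=> [g _] Gh Ga Gpi.
have [D [cD [_ [oX csD _] _]] Dg] := ample_bisection Ga g.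
(* The source of a compact open bisection around any arrow serves as the nonempty compact open
   set. *)
set X := @src G @` D in oX.
have cX : compact X by exact: continuous_compact.
have [B [B' [[[_ bB] [cB' [_ _ [oZ crB' _]]] sB sB'] [BB' rB rB']]]] :=
  Gpi X cX oX.
have [b [c [bc bX]]] := bisection_self_embedding bB sB rB.
(* The bisection [B] supplies the embedding, and the range of [B'] a set that its image misses. *)
set Z := @rng G @` B' in oZ BB' rB'.
have cZ : compact Z by exact: continuous_compact.
have Z0 : Z !=set0.
  have : X (src g) by exists g.
  by rewrite -sB' => -[h Bh _]; exists (rng h), h.
have dZ x : Z x -> ((fun y => rng (b y)) @` X) x -> False.
  by rewrite bX => Zx Bx; have : set0 x by rewrite -BB'.
pose Zn n := iter n (image^~ (fun x => rng (b x))) Z.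
have Zn_ n : [/\ open (Zn n), compact (Zn n), Zn n `<=` X & Zn n !=set0].
  elim: n => [//|n [oZn cZn ZnX [x Zx]]]; split.
  - exact: (emb_image_open Ga bc).
  - exact: (emb_image_compact Ga bc).
  - by move=> _ [y /ZnX Xy <-]; apply: (emb_in bc).
  - by exists (rng (b x)), x.
have dis m n x : m <> n -> Zn m x -> Zn n x -> False.
  move=> /eqP; rewrite neq_ltn => /orP[] mn Zm Zn'.
    exact: (emb_iter_disjoint bc rB' dZ mn Zm Zn').
  exact: (emb_iter_disjoint bc rB' dZ mn Zn' Zm).
have /choice[tau tauP] i : exists phi : homeo (units G),
    [/\ three_cycle phi, forall x, Zn (3 * i) x -> phi x = rng (b x) &
     forall x, ~ Zn (3 * i) x -> ~ Zn (3 * i).+1 x -> ~ Zn (3 * i).+2 x ->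
       phi x = x].
  have [oA cA AX A0] := Zn_ (3 * i).
  apply: (emb_three_cycle Gh Ga bc oA cA AX A0) => x.
  - by apply: (dis (3 * i) (3 * i).+1); lia.
  - by apply: (dis (3 * i) (3 * i).+2); lia.
  - by apply: (dis (3 * i).+1 (3 * i).+2); lia.
exists tau, (fun i => Zn (3 * i)); split=> [i|i|i j x ij Zj].
- by case: (tauP i).
- have [_ _ _ [x Zx]] := Zn_ (3 * i); exists x => // tx.
  apply: (dis (3 * i) (3 * i).+1 x) => //.
  by have [_ txE _] := tauP i; exists x; rewrite // -txE.
(* For [i <> j], the index [3 * j] is none of [3 * i], [3 * i + 1], [3 * i + 2], so [x] lies outside
   the three sets moved by [tau i]. *)
- have [_ _ ->//] := tauP i => Zi; apply: (dis _ _ _ _ Zi Zj); lia.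
Qed.

Theorem corollary3p11 (G : topGroupoidType)
    (Gnonempty : [set: G] !=set0) (Ghausdorff : hausdorff_space G)
    (Gmin : minimal G) (Gep : essentially_principal G)
    (Gample : ample G) (Gpi : purely_infinite G) :
  (forall (n : nat) (S : 'I_n -> homeo (units G)),
     generated (range S) = full_group G ->
     ~ solvable_gwp S (full_group G)) /\
  (forall (n : nat) (S : 'I_n -> homeo (units G)),
     generated (range S) = alternating_group G ->
     ~ solvable_gwp S (alternating_group G)).
Proof.
have [tau [U [tau3 tauU tauV]]] :=
  disjoint_three_cycles Gnonempty Ghausdorff Gample Gpi.
split=> n S genS; apply: (homeo_not_solvable_gwp genS _ tauU tauV) => i.
  by case: (tau3 i).
exact: sub_gen_smallest.
Qed.
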